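(* The following biorthogonality relations hold: $$\oint_{\mathbb T}B(z)\,\mathrm d\mu(z)\,\bar A(z^{-1})=I,\qquad \oint_{\mathbb T}\bar{\mathcal A}(z^{-1})\,\mathrm d\mu(z)\,\mathcal B(z)=I,$$ where $I$ is the semi-infinite identity matrix. Entrywise, for all $n,m\in\mathbb N_0$, $$\sum_{b=1}^q\sum_{a=1}^p\oint_{\mathbb T}B_n^{(b)}(z)\,\mathrm d\mu_{b,a}(z)\,\overline{A_m^{(a)}(z)}=\delta_{n,m},\qquad \sum_{b=1}^q\sum_{a=1}^p\oint_{\mathbb T}\overline{\mathcal A_n^{(b)}(z)}\,\mathrm d\mu_{b,a}(z)\,\mathcal B_m^{(a)}(z)=\delta_{n,m}.$$
   Context: Let $p,q\in\mathbb N$ and let $\mu=(\mu_{b,a})$ be a $q\times p$ matrix of complex Borel measures with infinite support on the unit circle $\mathbb T=\{|z|=1\}$. Rows and columns of semi-infinite matrices are indexed from $0$. For $r\in\mathbb N$, $Z_{[r]}(z)$ is the $\infty\times r$ matrix obtained by stacking the $r\times r$ blocks $I_r, z^{-1}I_r, zI_r, z^{-2}I_r, z^2I_r,\dots$ (block number $2N$ is $z^NI_r$, block number $2N+1$ is $z^{-N-1}I_r$). The left and right moment matrices are $$M=\oint_{\mathbb T}Z_{[q]}(z)\,\mathrm d\mu(z)\,Z_{[p]}^\top(z^{-1}),\qquad \mathcal M=\oint_{\mathbb T}Z_{[q]}(z^{-1})\,\mathrm d\mu(z)\,Z_{[p]}^\top(z).$$ It is assumed that they have Gauss--Borel factorizations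 $M=L^{-1}\bar U^{-1}$ and $\mathcal M=\bar{\mathcal L}^{-1}\mathcal U^{-1}$, with $L,\mathcal L$ lower triangular and $U,\mathcal U$ upper triangular semi-infinite matrices with nonzero diagonal entries (bar = entrywise complex conjugation). Put $$B(z)=LZ_{[q]}(z),\quad A(z)=Z_{[p]}^\top(z)U,\quad \mathcal A(z)=\mathcal LZ_{[q]}(z),\quad \mathcal B(z)=Z_{[p]}^\top(z)\,\mathcal U .$$ $B,\mathcal A$ are $\infty\times q$ with entries $B_n^{(b)},\mathcal A_n^{(b)}$ (row $n$, column $b$); $A,\mathcal B$ are $p\times\infty$ with entries $A_n^{(a)},\mathcal B_n^{(a)}$ (row $a$, column $n$). For a Laurent polynomial with matrix coefficients $P(z)=\sum P_kz^k$, $\bar P(z)=\sum\bar P_kz^k$; thus $\bar P(z^{-1})=\overline{P(z)}$ for $z\in\mathbb T$. *)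

(* Defs.v *)
From HB Require Import structures.
From mathcomp Require Import all_boot all_order all_algebra.
From mathcomp Require Import complex.
From mathcomp Require Import all_classical all_reals all_analysis.

Set Implicit Arguments.
Unset Strict Implicit.
Unset Printing Implicit Defensive.

Import Order.TTheory GRing.Theory Num.Theory.
Import numFieldNormedType.Exports.

Local Open Scope classical_set_scope.
Local Open Scope ring_scope.

Definition ucircle (R : realType) := {z : R[i] | `|z| == 1}.

HB.instance Definition _ (R : realType) := Choice.on (ucircle R).
HB.instance Definition _ (R : realType) := isPointed.Build (ucircle R)
  (exist (fun z : R[i] => `|z| == 1) 1 (introT eqP (normr1 R[i]))).

(* [R[i]^o] carries the usual topology of the complex plane; the circle gets
   the subspace topology and the corresponding Borel sets. *)
Definition ucircle_val (R : realType) (z : ucircle R) : R[i]^o := sval z.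

Definition ucircle_open (R : realType) : set (set (ucircle R)) :=
  @open (initial_topology (@ucircle_val R)).

Definition borel_circle (R : realType) := g_sigma_algebraType (@ucircle_open R).

(* A complex Borel measure on the circle is a pair of finite signed measures,
   its real and imaginary parts (charges are finite by definition). *)
Record cmeasure (R : realType) := CMeasure {
  cmeasure_re : {charge set (borel_circle R) -> \bar R} ;
  cmeasure_im : {charge set (borel_circle R) -> \bar R} }.

Definition cmeasure_val (R : realType) (mu : cmeasure R)
    (E : set (borel_circle R)) : R[i] :=
  Complex (fine (cmeasure_re mu E)) (fine (cmeasure_im mu E)).

Definition modulus (R : realType) (z : R[i]) : R := complex.Re `|z|.

Definition total_variation (R : realType) (mu : cmeasure R)
    (E : set (borel_circle R)) : \bar R :=
  ereal_sup [set s | exists F : (set (borel_circle R))^nat,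
    [/\ forall k, measurable (F k), trivIset setT F, \bigcup_k F k = E
      & s = (\sum_(0 <= k <oo) (modulus (cmeasure_val mu (F k)))%:E)%E]].

Definition cmeasure_support (R : realType) (mu : cmeasure R) :
    set (borel_circle R) :=
  [set z | forall V, ucircle_open V -> V z -> (0 < total_variation mu V)%E].

(* The result does not depend on the Hahn decomposition that is chosen. *)
Definition charge_integral d (T : measurableType d) (R : realType)
    (nu : {charge set T -> \bar R}) (f : T -> R) : R :=
  let hP := cid (Hahn_decomposition nu) in
  let hN := cid (svalP hP) in
  Rintegral (jordan_pos (svalP hN)) setT f -
  Rintegral (jordan_neg (svalP hN)) setT f.

Definition oint (R : realType) (mu : cmeasure R) (f : R[i] -> R[i]) : R[i] :=
  let f_re (z : borel_circle R) := complex.Re (f (ucircle_val z)) in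
  let f_im (z : borel_circle R) := complex.Im (f (ucircle_val z)) in
  Complex
    (charge_integral (cmeasure_re mu) f_re -
     charge_integral (cmeasure_im mu) f_im)
    (charge_integral (cmeasure_re mu) f_im +
     charge_integral (cmeasure_im mu) f_re).

Definition imatrix (K I J : Type) := I -> J -> K.

Definition imx1 (C : numClosedFieldType) : imatrix C nat nat := fun n m => (n == m)%:R.

Definition imx_tr (K I J : Type) (A : imatrix K I J) : imatrix K J I :=
  fun j i => A i j.

(* [\sum_(k \in D)] is the sum of a finitely supported family: the product is
   the usual one as soon as every entry is given by a finite sum, which is the
   case when the left factor is lower triangular or the right one upper
   triangular. *)
Definition imx_mul (C : numClosedFieldType) (I J : Type) (X : choiceType)
    (A : imatrix C I X) (B : imatrix C X J) : imatrix C I J :=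
  fun i j => \sum_(x \in [set: X]) A i x * B x j.

Definition imx_conj (C : numClosedFieldType) (I J : Type)
    (A : imatrix C I J) : imatrix C I J :=
  fun i j => (A i j)^*.

Definition lower_triangular (C : numClosedFieldType) (A : imatrix C nat nat) :=
  forall n m, (n < m)%N -> A n m = 0.

Definition upper_triangular (C : numClosedFieldType) (A : imatrix C nat nat) :=
  forall n m, (m < n)%N -> A n m = 0.

Definition nonzero_diagonal (C : numClosedFieldType) (A : imatrix C nat nat) :=
  forall n, A n n != 0.

Definition imx_inverse (C : numClosedFieldType) (A A' : imatrix C nat nat) :=
  imx_mul A A' = imx1 C /\ imx_mul A' A = imx1 C.

(* [M] is the product of the inverses of [X] and [Y], in this order. *)
Definition is_mul_inverses (C : numClosedFieldType) (M X Y : imatrix C nat nat) :=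
  exists X' Y', [/\ imx_inverse X X', imx_inverse Y Y' & M = imx_mul X' Y'].

(* A matrix-valued Laurent polynomial, given by its coefficients: [P k] is the
   coefficient of z^k. The number of nonzero coefficients may depend on the
   entry. *)
Definition laurent (K I J : Type) := int -> imatrix K I J.

Definition laurent_eval (C : numClosedFieldType) (I J : Type) (P : laurent C I J) (z : C) :
    imatrix C I J :=
  fun i j => \sum_(k \in [set: int]) P k i j * z ^ k.

Definition laurent_conj (C : numClosedFieldType) (I J : Type) (P : laurent C I J) :
    laurent C I J :=
  fun k => imx_conj (P k).

Definition laurent_tr (K I J : Type) (P : laurent K I J) : laurent K J I :=
  fun k => imx_tr (P k).

Definition laurent_mull (C : numClosedFieldType) (J : Type) (A : imatrix C nat nat)
    (P : laurent C nat J) : laurent C nat J :=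
  fun k => imx_mul A (P k).

Definition laurent_mulr (C : numClosedFieldType) (I : Type) (P : laurent C I nat)
    (A : imatrix C nat nat) : laurent C I nat :=
  fun k => imx_mul (P k) A.

(* The exponent in block [s] of Z_[r]: N if s = 2N, and - N - 1 if s = 2N + 1. *)
Definition block_exponent (s : nat) : int :=
  if odd s then - (s./2.+1)%:Z else (s./2)%:Z.

(* Row n of Z_[r] is row n %% r of block n %/ r. *)
Definition Zpoly (C : numClosedFieldType) (r : nat) : laurent C nat 'I_r :=
  fun k n b => ((k == block_exponent (n %/ r)) && (n %% r == b)%N)%:R.
Arguments Zpoly {C} r.

(* The integral of P(z) dmu(z) Q(z) over the unit circle. *)
Definition mxoint (R : realType) (q p : nat) (I J : Type)
    (P : R[i] -> imatrix R[i] I 'I_q) (mu : 'M[cmeasure R]_(q, p))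
    (Q : R[i] -> imatrix R[i] 'I_p J) : imatrix R[i] I J :=
  fun n m =>
    \sum_(b < q) \sum_(a < p) oint (mu b a) (fun z => P z n b * Q z a m).

Definition left_moment (R : realType) (q p : nat)
    (mu : 'M[cmeasure R]_(q, p)) : imatrix R[i] nat nat :=
  mxoint (fun z => laurent_eval (Zpoly q) z) mu (fun z => laurent_eval (laurent_tr (Zpoly p)) z^-1).

Definition right_moment (R : realType) (q p : nat)
    (mu : 'M[cmeasure R]_(q, p)) : imatrix R[i] nat nat :=
  mxoint (fun z => laurent_eval (Zpoly q) z^-1) mu (fun z => laurent_eval (laurent_tr (Zpoly p)) z).

(* Main.v *)
Require Import Defs.
From HB Require Import structures.
From mathcomp Require Import all_boot all_order all_algebra.
From mathcomp Require Import complex.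
From mathcomp Require Import all_classical all_reals all_analysis.
From mathcomp Require Import measurable_realfun ring.
Set Implicit Arguments.
Unset Strict Implicit.
Unset Printing Implicit Defensive.
Import Order.TTheory GRing.Theory Num.Theory.
Import numFieldNormedType.Exports.
Local Open Scope classical_set_scope.
Local Open Scope ring_scope.

(* Integrating B dmu A-bar term by term gives L M U-bar, since every entry of B
   and A is a finite linear combination of powers of z, and these are bounded
   Borel functions on the circle. With M = L^-1 U-bar^-1 this is the identity:
   truncating to the leading N x N blocks commutes with a product as soon as the
   left factor is lower triangular or the right one upper triangular, so the
   cancellation happens between finite matrices. *)

(** * Products, inverses and truncations of triangular semi-infinite matrices *)

Section semi_infinite.
Variable C : numClosedFieldType.
Implicit Types (A M X Y : imatrix C nat nat).

(** Row [n] of [A] vanishes from column [N] on. Any bound beyond [n] is allowed, so that one [N] can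
    serve all rows of a truncation, while [n.+1] serves a single row. *)
Lemma imx_mul_lower (J : Type) A (B : imatrix C nat J) n j N :
  lower_triangular A -> (n < N)%N ->
  imx_mul A B n j = \sum_(x < N) A n x * B x j.
Proof.
move=> lowA ltnN; rewrite /imx_mul (fsbigE (index_iota 0 N)) ?iota_uniq //.
  by under eq_bigl do rewrite in_setT; rewrite big_mkord.
move=> x _; rewrite mem_index_iota /= -leqNgt => leNx.
by rewrite lowA ?mul0r // (leq_trans ltnN).
Qed.

(** Reduces statements about upper triangular right factors to those about lower triangular left
    factors. *)
Lemma imx_tr_mul (I J : Type) (K : choiceType) (A : imatrix C I K)
    (B : imatrix C K J) :
  imx_mul A B = imx_tr (imx_mul (imx_tr B) (imx_tr A)).
Proof.
apply/funext => i; apply/funext => j.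
by apply: eq_fsbigr => x _; rewrite mulrC.
Qed.

Lemma lower_triangular_tr A : upper_triangular A -> lower_triangular (imx_tr A).
Proof. by move=> upA n m; exact: upA. Qed.

Lemma imx_mul_upper (I : Type) (B : imatrix C I nat) A i m N :
  upper_triangular A -> (m < N)%N ->
  imx_mul B A i m = \sum_(x < N) B i x * A x m.
Proof.
move=> /lower_triangular_tr lowA ltmN.
rewrite imx_tr_mul {1}/imx_tr (imx_mul_lower _ _ lowA ltmN).
by apply: eq_bigr => x _; rewrite mulrC.
Qed.

(* [A'] is not assumed to be lower triangular in [imx_inverse]; without this
   the entries of [imx_mul A' B] could be the junk value 0 of an infinite sum. *)
Lemma lower_triangular_inverse A A' :
  lower_triangular A -> nonzero_diagonal A -> imx_mul A A' = imx1 C ->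
  lower_triangular A'.
Proof.
move=> lowA diagA AA'; elim/ltn_ind => n IHn m ltnm.
have /eqP := congr1 (fun M : imatrix C nat nat => M n m) AA'.
rewrite (imx_mul_lower _ _ lowA (ltnSn n)) /imx1 big_ord_recr /= big1 ?add0r.
  by rewrite ltn_eqF // mulf_eq0 (negPf (diagA n)) => /eqP.
by move=> x _; rewrite IHn ?mulr0 // (ltn_trans _ ltnm).
Qed.

Definition imx_trunc N A : 'M[C]_N := \matrix_(i, j) A i j.

Lemma imx_trunc1 N : imx_trunc N (imx1 C) = 1%:M.
Proof. by apply/matrixP => i j; rewrite !mxE. Qed.

Lemma imx_trunc_mul_lower N A B : lower_triangular A ->
  imx_trunc N (imx_mul A B) = imx_trunc N A *m imx_trunc N B.
Proof.
move=> lowA; apply/matrixP => i j; rewrite !mxE (imx_mul_lower _ _ lowA (ltn_ord i)).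
by apply: eq_bigr => x _; rewrite !mxE.
Qed.

Lemma imx_trunc_mul_upper N A B : upper_triangular B ->
  imx_trunc N (imx_mul A B) = imx_trunc N A *m imx_trunc N B.
Proof.
move=> upB; apply/matrixP => i j; rewrite !mxE (imx_mul_upper _ _ upB (ltn_ord j)).
by apply: eq_bigr => x _; rewrite !mxE.
Qed.

(** Semi-infinite products need not associate, so the regrouping into [(X X') (Y' Y)] is done on
    finite blocks. Each product that occurs has a triangular factor on the appropriate side: [X] and
    [X'] on the left, [Y] on the right. *)
Lemma mul_inverses_eq1 M X Y :
  lower_triangular X -> nonzero_diagonal X -> upper_triangular Y ->
  is_mul_inverses M X Y -> imx_mul (imx_mul X M) Y = imx1 C.
Proof.
move=> lowX diagX upY [X' [Y' [[XX' _] [_ Y'Y] ->]]].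
have lowX' := lower_triangular_inverse lowX diagX XX'.
(* The smallest leading block that contains the entry [(n, m)]. *)
apply/funext => n; apply/funext => m; pose N := (maxn n m).+1.
have ltnN : (n < N)%N by rewrite ltnS leq_maxl.
have ltmN : (m < N)%N by rewrite ltnS leq_maxr.
suff: imx_trunc N (imx_mul (imx_mul X (imx_mul X' Y')) Y) = imx_trunc N (imx1 C).
  by move=> /matrixP /(_ (Ordinal ltnN) (Ordinal ltmN)); rewrite !mxE.
rewrite imx_trunc_mul_upper // imx_trunc_mul_lower // imx_trunc_mul_lower //.
rewrite mulmxA -imx_trunc_mul_lower // -mulmxA -imx_trunc_mul_upper //.
by rewrite XX' Y'Y imx_trunc1 mulmx1.
Qed.

Lemma upper_triangular_conj A : upper_triangular A -> upper_triangular (imx_conj A).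
Proof. by move=> upA n m ltmn; rewrite /imx_conj upA ?conjC0. Qed.

Lemma lower_triangular_conj A : lower_triangular A -> lower_triangular (imx_conj A).
Proof. by move=> lowA n m ltnm; rewrite /imx_conj lowA ?conjC0. Qed.

End semi_infinite.

(** * Evaluation and conjugation of Laurent polynomials with matrix coefficients *)

Section laurent_polynomials.
Variable C : numClosedFieldType.

(** The lists certify that each entry has finitely many exponents; they may be too long, contain
    repetitions and vary from entry to entry. *)
Definition laurent_support (I J : Type) (P : laurent C I J)
    (s : I -> J -> seq int) :=
  forall i j k, k \notin s i j -> P k i j = 0.

Lemma laurent_eval_seq (I J : Type) (P : laurent C I J) s (r : seq int) z i j :
  laurent_support P s -> uniq r -> {subset s i j <= r} ->
  laurent_eval P z i j = \sum_(k <- r) P k i j * z ^ k.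
Proof.
move=> sP uniq_r sr; rewrite /laurent_eval (fsbigE r) //.
  by under eq_bigl do rewrite in_setT.
by move=> k _ rk; rewrite (sP i j) ?mul0r //; apply: contra rk; exact: sr.
Qed.

(** Row [n] of the product only involves rows [0] to [n] of [P], so the sums over rows and over
    exponents are both finite and can be exchanged. *)
Lemma laurent_eval_mull (J : Type) (A : imatrix C nat nat) (P : laurent C nat J)
    s z : lower_triangular A -> laurent_support P s ->
  laurent_eval (laurent_mull A P) z = imx_mul A (laurent_eval P z).
Proof.
move=> lowA sP; apply/funext => n; apply/funext => j.
(* All exponents met in column [j] of rows [0] to [n]: one list over which every one of these
   entries can be expanded. *)
pose r := undup (flatten [seq s x j | x <- iota 0 n.+1]).
have sr x : (x < n.+1)%N -> {subset s x j <= r}.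
  move=> ltxn k skx; rewrite mem_undup; apply/flatten_mapP.
  by exists x; rewrite ?mem_iota.
have sAP : laurent_support (laurent_mull A P)
    (fun n' j' => undup (flatten [seq s x j' | x <- iota 0 n'.+1])).
  move=> n' j' k nk; rewrite /laurent_mull (imx_mul_lower _ _ lowA (ltnSn n')).
  apply: big1 => x _; rewrite sP ?mulr0 //; apply: contra nk => skx.
  rewrite mem_undup; apply/flatten_mapP.
  by exists (x : nat); rewrite ?mem_iota ?ltn_ord.
rewrite (laurent_eval_seq _ sAP (undup_uniq _) (fun=> id)) -/r.
rewrite (imx_mul_lower _ _ lowA (ltnSn n)).
under [RHS]eq_bigr => x _ do
  rewrite (laurent_eval_seq z sP (undup_uniq _) (sr x (ltn_ord x))) mulr_sumr.
rewrite exchange_big; apply: eq_bigr => k _.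
rewrite /laurent_mull (imx_mul_lower _ _ lowA (ltnSn n)) mulr_suml.
by apply: eq_bigr => x _; rewrite mulrA.
Qed.

Lemma laurent_eval_mulr (I : Type) (P : laurent C I nat) (A : imatrix C nat nat)
    s z : upper_triangular A -> laurent_support P s ->
  laurent_eval (laurent_mulr P A) z = imx_mul (laurent_eval P z) A.
Proof.
move=> /lower_triangular_tr lowA sP.
have -> : laurent_mulr P A = laurent_tr (laurent_mull (imx_tr A) (laurent_tr P)).
  by apply/funext => k; exact: imx_tr_mul.
have sPt : laurent_support (laurent_tr P) (fun j i => s i j).
  by move=> j i k; exact: sP.
have E := laurent_eval_mull z lowA sPt.
rewrite imx_tr_mul; apply/funext => i; apply/funext => m.
by have := congr1 (fun Q : imatrix C nat I => Q m i) E.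
Qed.

(** Conjugation vanishes only at 0, so both families have the same support; an infinite support
    gives the default value 0 on both sides. *)
Lemma fsum_conj (T : choiceType) (D : set T) (f : T -> C) :
  \sum_(x \in D) (f x)^* = (\sum_(x \in D) f x)^*.
Proof.
rewrite rmorph_sum /= /finite_support.
rewrite (_ : (fun x => (f x)^*) @^-1` [set~ 0] = f @^-1` [set~ 0]) //.
by apply/seteqP; split=> x /=; apply: contra_not => /eqP;
  rewrite ?conjC_eq0 => /eqP // ->; rewrite conjC0.
Qed.

Lemma laurent_eval_conj (I J : Type) (P : laurent C I J) z :
  laurent_eval (laurent_conj P) z = imx_conj (laurent_eval P z^*).
Proof.
apply/funext => i; apply/funext => j; rewrite /imx_conj /laurent_eval -fsum_conj.
by apply: eq_fsbigr => k _; rewrite rmorphM fmorphXz /= conjCK.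
Qed.

Lemma imx_conj_mul (I J : Type) (X : choiceType) (A : imatrix C I X)
    (B : imatrix C X J) :
  imx_conj (imx_mul A B) = imx_mul (imx_conj A) (imx_conj B).
Proof.
apply/funext => i; apply/funext => j; rewrite /imx_conj /imx_mul -fsum_conj.
by apply: eq_fsbigr => x _; rewrite rmorphM.
Qed.

Lemma Zpoly_support r : laurent_support (@Zpoly C r)
  (fun n _ => [:: block_exponent (n %/ r)]).
Proof. by move=> n b k; rewrite inE /Zpoly => /negPf ->. Qed.

Lemma Zpoly_conj r : laurent_conj (@Zpoly C r) = Zpoly r.
Proof.
apply/funext => k; apply/funext => n; apply/funext => b.
by rewrite /laurent_conj /imx_conj conjC_nat.
Qed.

End laurent_polynomials.

(** * Linearity of the integral against a charge, for bounded measurable functions *)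

Section bounded_measurable.
Context d (T : measurableType d) (R : realType).
Implicit Types (f g : T -> R) (c : R).

Definition bounded_measurable f :=
  measurable_fun setT f /\ exists c, forall x, `|f x| <= c.

Lemma bounded_measurable_cst c : bounded_measurable (fun=> c).
Proof. by split; [exact: measurable_cst | exists `|c|]. Qed.

Lemma bounded_measurableD f g : bounded_measurable f -> bounded_measurable g ->
  bounded_measurable (fun x => f x + g x).
Proof.
move=> [mf [a fa]] [mg [b gb]]; split; first exact: measurable_funD.
by exists (a + b) => x; rewrite (le_trans (ler_normD _ _)) // lerD.
Qed.

Lemma bounded_measurableM f g : bounded_measurable f -> bounded_measurable g ->
  bounded_measurable (fun x => f x * g x).
Proof.
move=> [mf [a fa]] [mg [b gb]]; split; first exact: measurable_funM.
by exists (a * b) => x; rewrite normrM ler_pM.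
Qed.

Lemma bounded_measurableZ c f : bounded_measurable f ->
  bounded_measurable (fun x => c * f x).
Proof. by apply: bounded_measurableM; exact: bounded_measurable_cst. Qed.

Lemma bounded_measurableN f : bounded_measurable f ->
  bounded_measurable (fun x => - f x).
Proof.
by move=> /(bounded_measurableZ (-1)); under eq_fun do rewrite mulN1r.
Qed.

Lemma bounded_measurable_integrable (m : {finite_measure set T -> \bar R}) f :
  bounded_measurable f -> m.-integrable setT (EFin \o f).
Proof.
move=> [mf [c fc]]; apply: measurable_bounded_integrable => //.
  exact: fin_num_fun_lty.
exists c; split; first exact: num_real.
by move=> e ce x _ /=; rewrite (le_trans (fc x)) // ltW.
Qed.

(** The Hahn decomposition chosen in [charge_integral] depends on [nu] alone, so all three integrals
    use the same Jordan parts. These are finite measures, for which bounded measurable functions are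
    integrable. *)
Lemma charge_integralD (nu : {charge set T -> \bar R}) f g :
  bounded_measurable f -> bounded_measurable g ->
  charge_integral nu (fun x => f x + g x) =
  charge_integral nu f + charge_integral nu g.
Proof.
move=> bf bg; rewrite /charge_integral !RintegralD //;
  try exact: bounded_measurable_integrable.
by rewrite opprD addrACA.
Qed.

Lemma charge_integralZ (nu : {charge set T -> \bar R}) c f :
  bounded_measurable f ->
  charge_integral nu (fun x => c * f x) = c * charge_integral nu f.
Proof.
move=> bf; rewrite /charge_integral !RintegralZl //;
  try exact: bounded_measurable_integrable.
by rewrite mulrBr.
Qed.

End bounded_measurable.

(** * Complex integrals over the unit circle *)

Section circle.
Variable R : realType.
Implicit Types (f g : R[i] -> R[i]) (c : R[i]) (mu : cmeasure R).

Definition circle_re f (z : borel_circle R) := complex.Re (f (ucircle_val z)).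
Definition circle_im f (z : borel_circle R) := complex.Im (f (ucircle_val z)).

(** Only the values on the circle are constrained, which admits functions such as [z^-1]. *)
Definition bounded_borel f :=
  bounded_measurable (circle_re f) /\ bounded_measurable (circle_im f).

Lemma ReD c c' : complex.Re (c + c') = complex.Re c + complex.Re c'.
Proof. by case: c; case: c'. Qed.

Lemma ImD c c' : complex.Im (c + c') = complex.Im c + complex.Im c'.
Proof. by case: c; case: c'. Qed.

Lemma ReM c c' : complex.Re (c * c') =
  complex.Re c * complex.Re c' - complex.Im c * complex.Im c'.
Proof. by case: c; case: c'. Qed.

Lemma ImM c c' : complex.Im (c * c') =
  complex.Re c * complex.Im c' + complex.Im c * complex.Re c'.
Proof. by case: c => a b; case: c' => a' b' /=; rewrite [b * _]mulrC. Qed.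

Lemma circle_reD f g : circle_re (fun z => f z + g z) =
  (fun x => circle_re f x + circle_re g x).
Proof. by apply/funext => x; exact: ReD. Qed.

Lemma circle_imD f g : circle_im (fun z => f z + g z) =
  (fun x => circle_im f x + circle_im g x).
Proof. by apply/funext => x; exact: ImD. Qed.

Lemma circle_reM f g : circle_re (fun z => f z * g z) =
  (fun x => circle_re f x * circle_re g x + - (circle_im f x * circle_im g x)).
Proof. by apply/funext => x; exact: ReM. Qed.

Lemma circle_imM f g : circle_im (fun z => f z * g z) =
  (fun x => circle_re f x * circle_im g x + circle_im f x * circle_re g x).
Proof. by apply/funext => x; exact: ImM. Qed.

Lemma circle_reZ c f : circle_re (fun z => c * f z) =
  (fun x => complex.Re c * circle_re f x + - complex.Im c * circle_im f x).
Proof. by apply/funext => x; rewrite mulNr; exact: ReM. Qed.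

Lemma circle_imZ c f : circle_im (fun z => c * f z) =
  (fun x => complex.Re c * circle_im f x + complex.Im c * circle_re f x).
Proof. by apply/funext => x; exact: ImM. Qed.

Lemma bounded_borel_cst c : bounded_borel (fun=> c).
Proof. by split; exact: bounded_measurable_cst. Qed.

Lemma bounded_borelD f g : bounded_borel f -> bounded_borel g ->
  bounded_borel (fun z => f z + g z).
Proof.
move=> [fr fi] [gr gi]; rewrite /bounded_borel circle_reD circle_imD.
by split; exact: bounded_measurableD.
Qed.

Lemma bounded_borelM f g : bounded_borel f -> bounded_borel g ->
  bounded_borel (fun z => f z * g z).
Proof.
move=> [fr fi] [gr gi]; rewrite /bounded_borel circle_reM circle_imM.
split; apply: bounded_measurableD; try exact: bounded_measurableM.
by apply: bounded_measurableN; exact: bounded_measurableM.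
Qed.

Lemma bounded_borel_sum (I : Type) (r : seq I) (F : I -> R[i] -> R[i]) :
  (forall i, bounded_borel (F i)) -> bounded_borel (fun z => \sum_(i <- r) F i z).
Proof.
move=> bF; elim: r => [|i r IHr].
  by under eq_fun do rewrite big_nil; exact: bounded_borel_cst.
by under eq_fun do rewrite big_cons; exact: bounded_borelD.
Qed.

Lemma bounded_borelX f n : bounded_borel f -> bounded_borel (fun z => f z ^+ n).
Proof.
move=> bf; elim: n => [|n IHn]; first exact: bounded_borel_cst.
by under eq_fun do rewrite exprS; exact: bounded_borelM.
Qed.

Lemma ointE mu f : oint mu f = Complex
  (charge_integral (cmeasure_re mu) (circle_re f) -
   charge_integral (cmeasure_im mu) (circle_im f))
  (charge_integral (cmeasure_re mu) (circle_im f) +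
   charge_integral (cmeasure_im mu) (circle_re f)).
Proof. by []. Qed.

Lemma ointD mu f g : bounded_borel f -> bounded_borel g ->
  oint mu (fun z => f z + g z) = oint mu f + oint mu g.
Proof.
move=> [fr fi] [gr gi].
rewrite !ointE circle_reD circle_imD !charge_integralD //.
by apply/eqP; rewrite eq_complex /= opprD addrACA eqxx /= addrACA.
Qed.

Lemma ointZ mu c f : bounded_borel f ->
  oint mu (fun z => c * f z) = c * oint mu f.
Proof.
move=> [fr fi]; rewrite !ointE circle_reZ circle_imZ.
rewrite !charge_integralD ?charge_integralZ //; try exact: bounded_measurableZ.
move: (charge_integral _ _) (charge_integral _ _) (charge_integral _ _)
  (charge_integral _ _) => t u v w.
by case: c => x y; congr Complex => /=; ring.
Qed.

Lemma oint_sum mu (I : Type) (r : seq I) (c : I -> R[i]) (F : I -> R[i] -> R[i]) :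
  (forall i, bounded_borel (F i)) ->
  oint mu (fun z => \sum_(i <- r) c i * F i z) = \sum_(i <- r) c i * oint mu (F i).
Proof.
move=> bF; elim: r => [|i r IHr].
  (* The zero integrand is written as [0 * 0], so that homogeneity makes its integral vanish. *)
  rewrite big_nil; under eq_fun do rewrite big_nil -(mulr0 0).
  by rewrite ointZ ?mul0r //; exact: bounded_borel_cst.
rewrite big_cons; under eq_fun do rewrite big_cons.
rewrite ointD ?IHr ?ointZ //; last apply: bounded_borel_sum => j.
all: by apply: bounded_borelM => //; exact: bounded_borel_cst.
Qed.

(** Allows [z^-1] and [z^*] to be interchanged under the integral sign. *)
Lemma eq_oint mu f g : (forall z, `|z| = 1 -> f z = g z) -> oint mu f = oint mu g.
Proof.
move=> fg; suff E (z : ucircle R) : f (ucircle_val z) = g (ucircle_val z).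
  have Er : circle_re f = circle_re g.
    by apply/funext => z; rewrite /circle_re E.
  have Ei : circle_im f = circle_im g.
    by apply/funext => z; rewrite /circle_im E.
  by rewrite !ointE Er Ei.
by apply: fg; apply/eqP; exact: (valP z).
Qed.

(** * Boundedness and measurability of powers of z on the circle *)

Lemma circle_conj (z : R[i]) : `|z| = 1 -> z^* = z^-1.
Proof. by move=> z1; rewrite invC_norm z1 expr1n invr1 mul1r. Qed.

Lemma Re_conj c : complex.Re (c^*) = complex.Re c.
Proof. by case: c. Qed.

Lemma Im_conj c : complex.Im (c^*) = - complex.Im c.
Proof. by case: c. Qed.

Lemma normc_ge_Im c : `|complex.Im c|%:C%C <= `|c|.
Proof.
(* Multiplication by ['i] keeps the modulus and turns the imaginary part into minus the real
   part. *)
have := normc_ge_Re (c * 'i%C).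
by rewrite ReiNIm normrN normrM (_ : `|'i%C| = 1) ?mulr1 // complexiE normCi.
Qed.

Lemma continuous_Re : continuous (@complex.Re R : R[i]^o -> R).
Proof.
move=> x; apply/(@cvgrPdist_lt _ _ _ (nbhs (x : R[i]^o))) => e e0; apply/nbhs_ballP.
exists e%:C%C; first by rewrite /= ltcR.
move=> y; rewrite -ball_normE /= => xye; rewrite -ltcR -raddfB.
exact: le_lt_trans (normc_ge_Re _) xye.
Qed.

Lemma continuous_Im : continuous (@complex.Im R : R[i]^o -> R).
Proof.
move=> x; apply/(@cvgrPdist_lt _ _ _ (nbhs (x : R[i]^o))) => e e0; apply/nbhs_ballP.
exists e%:C%C; first by rewrite /= ltcR.
move=> y; rewrite -ball_normE /= => xye; rewrite -ltcR -raddfB.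
exact: le_lt_trans (normc_ge_Im _) xye.
Qed.

(** Open rays generate the Borel sets of the line, and their preimages are traces on the circle of
    open subsets of the plane, hence generators of the Borel sets there. *)
Lemma measurable_circle_continuous (h : R[i]^o -> R) : continuous h ->
  measurable_fun setT (fun z : borel_circle R => h (ucircle_val z)).
Proof.
move=> /continuousP ch; apply: (measurability _ (RGenOInfty.measurableE R)).
move=> _ [_ [x ->] <-]; rewrite setTI; apply: sub_sigma_algebra.
by exists (h @^-1` `]x, +oo[); first exact/ch/interval_open.
Qed.

Lemma bounded_borel_id : bounded_borel id.
Proof.
have norm1 (z : ucircle R) : `|ucircle_val z| = 1 :> R[i] by apply/eqP; exact: (valP z).
split; split.
- exact: measurable_circle_continuous continuous_Re.
- by exists 1 => z; rewrite -lecR (le_trans (normc_ge_Re _)) ?norm1.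
- exact: measurable_circle_continuous continuous_Im.
- by exists 1 => z; rewrite -lecR (le_trans (normc_ge_Im _)) ?norm1.
Qed.

(** On the circle inversion is conjugation, so its coordinates are those of the identity up to a
    sign; the pole at 0 never enters. *)
Lemma bounded_borelV : bounded_borel (fun z => z^-1).
Proof.
have [reP imP] := bounded_borel_id.
have valV (z : ucircle R) : (ucircle_val z)^-1 = (ucircle_val z)^* :> R[i].
  by rewrite circle_conj //; apply/eqP; exact: (valP z).
rewrite /bounded_borel; split.
  by rewrite (_ : circle_re _ = circle_re id) //; apply/funext => z;
    rewrite /circle_re valV Re_conj.
rewrite (_ : circle_im _ = (fun z => - circle_im id z)).
  exact: bounded_measurableN.
by apply/funext => z; rewrite /circle_im valV Im_conj.
Qed.

Lemma bounded_borelXz (k : int) : bounded_borel (fun z => z ^ k).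
Proof.
case: k => n; first exact: bounded_borelX bounded_borel_id.
under eq_fun do rewrite NegzE -exprz_inv.
exact: bounded_borelX bounded_borelV.
Qed.

Lemma bounded_borel_laurent (I J : Type) (P : laurent R[i] I J) s i j :
  laurent_support P s -> bounded_borel (fun z => laurent_eval P z i j).
Proof.
move=> sP; have sr : {subset s i j <= undup (s i j)} by move=> k; rewrite mem_undup.
under eq_fun do rewrite (laurent_eval_seq _ sP (undup_uniq _) sr).
apply: bounded_borel_sum => k; apply: bounded_borelM; first exact: bounded_borel_cst.
exact: bounded_borelXz.
Qed.

Lemma bounded_borel_laurentV (I J : Type) (P : laurent R[i] I J) s i j :
  laurent_support P s -> bounded_borel (fun z => laurent_eval P z^-1 i j).
Proof.
move=> sP; have sr : {subset s i j <= undup (s i j)} by move=> k; rewrite mem_undup.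
under eq_fun do rewrite (laurent_eval_seq _ sP (undup_uniq _) sr).
apply: bounded_borel_sum => k; apply: bounded_borelM; first exact: bounded_borel_cst.
under eq_fun do rewrite exprz_inv; exact: bounded_borelXz.
Qed.

(** By triangularity the entry [(n, m)] involves only rows up to [n] of [F] and columns up to [m] of
    [G]; linearity of [oint] over this finite sum takes the coefficients out. *)
Lemma mxoint_mul (q p : nat) (mu : 'M[cmeasure R]_(q, p))
    (F : R[i] -> imatrix R[i] nat 'I_q) (G : R[i] -> imatrix R[i] 'I_p nat)
    (X Y : imatrix R[i] nat nat) :
  lower_triangular X -> upper_triangular Y ->
  (forall n b, bounded_borel (fun z => F z n b)) ->
  (forall a m, bounded_borel (fun z => G z a m)) ->
  mxoint (fun z => imx_mul X (F z)) mu (fun z => imx_mul (G z) Y) =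
  imx_mul (imx_mul X (mxoint F mu G)) Y.
Proof.
move=> lowX upY bF bG; apply/funext => n; apply/funext => m.
rewrite (imx_mul_upper _ _ upY (ltnSn m)).
under [RHS]eq_bigr do rewrite (imx_mul_lower _ _ lowX (ltnSn n)) mulr_suml.
rewrite pair_big /=.
(* The double sum is indexed by pairs, so that [oint_sum] applies once: [u.1] is a column of [G],
   [u.2] a row of [F]. *)
transitivity (\sum_(b < q) \sum_(a < p) \sum_(u : 'I_m.+1 * 'I_n.+1)
   X n u.2 * Y u.1 m * oint (mu b a) (fun z => F z u.2 b * G z a u.1)).
  apply: eq_bigr => b _; apply: eq_bigr => a _.
  rewrite -oint_sum => [|u]; last exact: bounded_borelM.
  congr oint; apply/funext => z.
  rewrite (imx_mul_upper _ _ upY (ltnSn m)) (imx_mul_lower _ _ lowX (ltnSn n)).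
  rewrite mulr_sumr; under eq_bigr do rewrite mulr_suml.
  by rewrite pair_big; apply: eq_bigr => u _ /=; ring.
under [LHS]eq_bigr => b _ do rewrite exchange_big /=.
rewrite [LHS]exchange_big /=.
apply: eq_bigr => u _; rewrite /mxoint mulr_sumr mulr_suml; apply: eq_bigr => b _.
by rewrite mulr_sumr mulr_suml; apply: eq_bigr => a _; ring.
Qed.

(** Common form of both relations: [X], [Y] are [L], [imx_conj U] for the left moment matrix and
    [imx_conj cL], [cU] for the right one. *)
Lemma mxoint_biorthogonal (q p : nat) (mu : 'M[cmeasure R]_(q, p))
    (F : R[i] -> imatrix R[i] nat 'I_q) (G : R[i] -> imatrix R[i] 'I_p nat)
    (X Y : imatrix R[i] nat nat) :
  lower_triangular X -> nonzero_diagonal X -> upper_triangular Y ->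
  (forall n b, bounded_borel (fun z => F z n b)) ->
  (forall a m, bounded_borel (fun z => G z a m)) ->
  is_mul_inverses (mxoint F mu G) X Y ->
  mxoint (fun z => imx_mul X (F z)) mu (fun z => imx_mul (G z) Y) = imx1 R[i].
Proof. by move=> lowX dX upY bF bG MXY; rewrite mxoint_mul // (mul_inverses_eq1 lowX). Qed.

End circle.

Theorem proposition2p12 (R : realType) (p q : nat) (p_gt0 : (0 < p)%N)
    (q_gt0 : (0 < q)%N) (mu : 'M[cmeasure R]_(q, p))
    (mu_infinite : forall b a, infinite_set (cmeasure_support (mu b a)))
    (L U cL cU : imatrix R[i] nat nat)
    (L_lower : lower_triangular L) (L_diag : nonzero_diagonal L)
    (U_upper : upper_triangular U) (U_diag : nonzero_diagonal U)
    (cL_lower : lower_triangular cL) (cL_diag : nonzero_diagonal cL)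
    (cU_upper : upper_triangular cU) (cU_diag : nonzero_diagonal cU)
    (left_GB : is_mul_inverses (left_moment mu) L (imx_conj U))
    (right_GB : is_mul_inverses (right_moment mu) (imx_conj cL) cU) :
  let B := laurent_mull L (Zpoly q) in
  let A := laurent_mulr (laurent_tr (Zpoly p)) U in
  let cA := laurent_mull cL (Zpoly q) in
  let cB := laurent_mulr (laurent_tr (Zpoly p)) cU in
  [/\ mxoint (fun z => laurent_eval B z) mu (fun z => laurent_eval (laurent_conj A) z^-1) =
        imx1 R[i],
      mxoint (fun z => laurent_eval (laurent_conj cA) z^-1) mu (fun z => laurent_eval cB z) =
        imx1 R[i],
      forall n m : nat,
        \sum_(b < q) \sum_(a < p)
          oint (mu b a) (fun z => laurent_eval B z n b * (laurent_eval A z a m)^*) =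
        (n == m)%:R
    & forall n m : nat,
        \sum_(b < q) \sum_(a < p)
          oint (mu b a) (fun z => (laurent_eval cA z n b)^* * laurent_eval cB z a m) =
        (n == m)%:R].
Proof.
move=> B A cA cB.
have sq := @Zpoly_support R[i] q.
have sp : laurent_support (laurent_tr (@Zpoly R[i] p)) (fun _ n => [:: block_exponent (n %/ p)]).
  by move=> a n k; exact: Zpoly_support.
(* The coefficients of [Zpoly] are 0 or 1, so conjugation only affects the triangular factor. *)
have conjA : laurent_conj A = laurent_mulr (laurent_tr (Zpoly p)) (imx_conj U).
  apply/funext => k; rewrite -[in RHS]Zpoly_conj; exact: imx_conj_mul.
have conjcA : laurent_conj cA = laurent_mull (imx_conj cL) (Zpoly q).
  apply/funext => k; rewrite -[in RHS]Zpoly_conj; exact: imx_conj_mul.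
have left1 : mxoint (fun z => laurent_eval B z) mu
    (fun z => laurent_eval (laurent_conj A) z^-1) = imx1 R[i].
  rewrite conjA.
  have -> : (fun z => laurent_eval B z) =
      (fun z => imx_mul L (laurent_eval (Zpoly q) z)).
    by apply/funext => z; exact: laurent_eval_mull sq.
  have -> : (fun z : R[i] => laurent_eval
        (laurent_mulr (laurent_tr (Zpoly p)) (imx_conj U)) z^-1) =
      (fun z => imx_mul (laurent_eval (laurent_tr (Zpoly p)) z^-1) (imx_conj U)).
    by apply/funext => z; apply: laurent_eval_mulr sp; exact: upper_triangular_conj.
  apply: mxoint_biorthogonal left_GB => //.
  - exact: upper_triangular_conj.
  - by move=> n b; exact: bounded_borel_laurent sq.
  - by move=> a m; exact: bounded_borel_laurentV sp.
have right1 : mxoint (fun z => laurent_eval (laurent_conj cA) z^-1) mu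
    (fun z => laurent_eval cB z) = imx1 R[i].
  rewrite conjcA.
  have -> : (fun z : R[i] => laurent_eval
        (laurent_mull (imx_conj cL) (Zpoly q)) z^-1) =
      (fun z => imx_mul (imx_conj cL) (laurent_eval (Zpoly q) z^-1)).
    by apply/funext => z; apply: laurent_eval_mull sq; exact: lower_triangular_conj.
  have -> : (fun z => laurent_eval cB z) =
      (fun z => imx_mul (laurent_eval (laurent_tr (Zpoly p)) z) cU).
    by apply/funext => z; exact: laurent_eval_mulr sp.
  apply: mxoint_biorthogonal right_GB => //.
  - exact: lower_triangular_conj.
  - by move=> n; rewrite /imx_conj conjC_eq0.
  - by move=> n b; exact: bounded_borel_laurentV sq.
  - by move=> a m; exact: bounded_borel_laurent sp.
split; [exact: left1 | exact: right1 | move=> n m | move=> n m].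
- rewrite -[RHS]/(imx1 R[i] n m) -left1; apply: eq_bigr => b _; apply: eq_bigr => a _.
  (* Conjugating the coefficients and evaluating at [z^-1] gives the conjugate of [A] at [(z^-1)^*],
     and this point is [z] itself on the circle. *)
  apply: eq_oint => z z1; rewrite laurent_eval_conj /imx_conj.
  by rewrite -(circle_conj z1) conjCK.
- rewrite -[RHS]/(imx1 R[i] n m) -right1; apply: eq_bigr => b _; apply: eq_bigr => a _.
  apply: eq_oint => z z1; rewrite laurent_eval_conj /imx_conj.
  by rewrite -(circle_conj z1) conjCK.
Qed.
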